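(* Let $m>0$ and define, for $p\in\mathbb{R}$, $$T_H(p)=p\,\operatorname{arsinh}(p/m)-\sqrt{m^2+p^2}+m,\qquad H_{\mathrm{SR}}(p)=\sqrt{m^2+p^2}-m.$$ Then $T_H$ and $H_{\mathrm{SR}}$ are distinct functions on $\mathbb{R}$. More precisely: (i) Let $f(p):=T_H(p)-H_{\mathrm{SR}}(p)=p\,\operatorname{arsinh}(p/m)-2\sqrt{m^2+p^2}+2m$. Then $f''(p)=\dfrac{p^2}{(m^2+p^2)^{3/2}}\ge 0$, with equality only at $p=0$, so $f$ is convex on $\mathbb{R}$ and strictly convex off the single point $p=0$ (i.e. on any open interval not containing $0$). Moreover $f(0)=0$, $f'(0)=0$, and $T_H(p)>H_{\mathrm{SR}}(p)$ for every $p\ne 0$. (ii) As $p\to 0$, $$T_H(p)=\frac{p^2}{2m}-\frac{p^4}{24m^3}+O(p^6/m^5),\qquad H_{\mathrm{SR}}(p)=\frac{p^2}{2m}-\frac{p^4}{8m^3}+O(p^6/m^5),$$ so $T_H(p)-H_{\mathrm{SR}}(p)=\dfrac{p^4}{12m^3}+O(p^6/m^5)$.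
   Context: $T_H$ is the Legendre transform of $v\mapsto m(\cosh v-1)$ and $H_{\mathrm{SR}}$ is the special-relativistic free-particle Hamiltonian (units $c=1$) with rest energy subtracted. *)

(* Defs.v *)
From Stdlib Require Import Reals.
From Coquelicot Require Import Coquelicot.
Open Scope R_scope.

Definition T_H (m p : R) : R := p * arcsinh (p / m) - sqrt (m ^ 2 + p ^ 2) + m.

Definition H_SR (m p : R) : R := sqrt (m ^ 2 + p ^ 2) - m.

Definition convex_on (D : R -> Prop) (f : R -> R) : Prop :=
  forall x y t : R, D x -> D y -> 0 <= t <= 1 ->
    f (t * x + (1 - t) * y) <= t * f x + (1 - t) * f y.

Definition strictly_convex_on (D : R -> Prop) (f : R -> R) : Prop :=
  forall x y t : R, D x -> D y -> x <> y -> 0 < t < 1 ->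
    f (t * x + (1 - t) * y) < t * f x + (1 - t) * f y.

(* The endpoints may be infinite. *)
Definition Rbar_interval (a b : Rbar) (x : R) : Prop :=
  Rbar_lt a x /\ Rbar_lt x b.

(* [g m p = O(h m p)] as [p -> 0] for every [m > 0].  The implied constant [K]
   does not depend on [m], so that powers of [m] in [h] are significant; the
   neighbourhood of [0] may depend on [m]. *)
Definition bigO_at_0 (g h : R -> R -> R) : Prop :=
  exists K : R, forall m : R, 0 < m ->
    locally 0 (fun p : R => Rabs (g m p) <= K * Rabs (h m p)).

(* Main.v *)
(** Writing [s = sqrt (m^2 + p^2)], one has [T_H' = arcsinh (p/m)], [T_H'' = 1/s]
    and [H_SR' = p/s], so [f' = arcsinh (p/m) - p/s] and [f'' = p^2/s^3].  Since
    [f''] vanishes only at [0], [f'] is strictly increasing on the whole line, and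
    [f] is strictly convex everywhere; [f > 0] off [0] follows from
    [f 0 = f' 0 = 0].  For the expansions, substituting [p^2 = s^2 - m^2]
    factors the remainder of [H_SR] as [(s-m)^3 (s+3m) / (8 m^3)] and the remainder
    of [T_H''] as [(s-m)^2 (s+2m) / (2 m^3 s)]; the latter is integrated twice. *)
Require Import Defs.
From Stdlib Require Import Reals Lra.
From Coquelicot Require Import Coquelicot.
Open Scope R_scope.

(** * Mean value arguments: monotonicity, convexity, positivity and power bounds *)

Lemma MVT_is_derive (f g : R -> R) (a b : R) :
  a < b -> (forall x, is_derive f x (g x)) ->
  exists c, f b - f a = g c * (b - a) /\ a < c < b.
Proof.
  intros Hab Hd. apply MVT_cor2; [exact Hab|].
  intros c _. apply is_derive_Reals, Hd.
Qed.

(** On an interval lying on one side of [z], the mean value point is strictly interior, hence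
    different from [z]. An interval that contains [z] in its interior is cut there. *)
Lemma strict_incr_derive_pos_except (f g : R -> R) (z : R) :
  (forall x, is_derive f x (g x)) -> (forall x, x <> z -> 0 < g x) ->
  forall x y, x < y -> f x < f y.
Proof.
  intros Hd Hpos.
  assert (Hside : forall x y, x < y -> y <= z \/ z <= x -> f x < f y).
  { intros x y Hxy Hz.
    destruct (MVT_is_derive f g x y Hxy Hd) as [c [Hc Hcxy]].
    assert (0 < g c) by (apply Hpos; lra). nra. }
  intros x y Hxy.
  destruct (Rle_lt_dec y z) as [Hy|Hy]; [apply Hside; auto|].
  destruct (Rle_lt_dec z x) as [Hx|Hx]; [apply Hside; auto|].
  apply Rlt_trans with (f z); apply Hside; auto using Rle_refl.
Qed.

(** The mean value theorem on both sides of [z = t * x + (1 - t) * y] gives slopes [g c1 < g c2],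
    and the convexity gap at [z] is exactly [t * (1 - t) * (y - x) * (g c2 - g c1)]. *)
Lemma strictly_convex_of_incr_derive (f g : R -> R) :
  (forall x, is_derive f x (g x)) -> (forall x y, x < y -> g x < g y) ->
  strictly_convex_on (fun _ => True) f.
Proof.
  intros Hd Hg.
  assert (Hlt : forall x y t, x < y -> 0 < t < 1 ->
    f (t * x + (1 - t) * y) < t * f x + (1 - t) * f y).
  { intros x y t Hxy Ht.
    set (z := t * x + (1 - t) * y).
    assert (Hzx : z - x = (1 - t) * (y - x)) by (unfold z; ring).
    assert (Hyz : y - z = t * (y - x)) by (unfold z; ring).
    assert (Hxz : x < z) by nra. assert (Hzy : z < y) by nra.
    destruct (MVT_is_derive f g x z Hxz Hd) as [c1 [H1 H1']].
    destruct (MVT_is_derive f g z y Hzy Hd) as [c2 [H2 H2']].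
    rewrite Hzx in H1. rewrite Hyz in H2.
    assert (Hc : g c1 < g c2) by (apply Hg; lra).
    assert (Hw : 0 < t * (1 - t) * (y - x)).
    { apply Rmult_lt_0_compat; [apply Rmult_lt_0_compat|]; lra. }
    replace (f x) with (f z - g c1 * ((1 - t) * (y - x))) by lra.
    replace (f y) with (f z + g c2 * (t * (y - x))) by lra.
    assert (0 < t * (1 - t) * (y - x) * (g c2 - g c1))
      by (apply Rmult_lt_0_compat; lra).
    lra. }
  intros x y t _ _ Hxy Ht.
  destruct (Rtotal_order x y) as [H|[H|H]]; [auto|contradiction|].
  replace (t * x + (1 - t) * y) with ((1 - t) * y + (1 - (1 - t)) * x) by ring.
  replace (t * f x + (1 - t) * f y)
    with ((1 - t) * f y + (1 - (1 - t)) * f x) by ring.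
  apply Hlt; lra.
Qed.

Lemma strictly_convex_on_subset (D E : R -> Prop) (f : R -> R) :
  (forall x, D x -> E x) -> strictly_convex_on E f -> strictly_convex_on D f.
Proof. intros HDE Hf x y t Hx Hy. apply Hf; auto. Qed.

Lemma strictly_convex_convex (D : R -> Prop) (f : R -> R) :
  strictly_convex_on D f -> convex_on D f.
Proof.
  intros Hf x y t Hx Hy Ht.
  destruct (Req_dec x y) as [<-|Hxy].
  { replace (t * x + (1 - t) * x) with x by ring. lra. }
  destruct (Req_dec t 0) as [->|H0].
  { replace (0 * x + (1 - 0) * y) with y by ring. lra. }
  destruct (Req_dec t 1) as [->|H1].
  { replace (1 * x + (1 - 1) * y) with x by ring. lra. }
  apply Rlt_le, Hf; auto; lra.
Qed.

(** By the mean value theorem [f p = g c * p] with [c] strictly between [0] and [p]. Monotonicity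
    and [g 0 = 0] give [g c] the sign of [p]. *)
Lemma pos_of_incr_derive (f g : R -> R) :
  (forall x, is_derive f x (g x)) -> (forall x y, x < y -> g x < g y) ->
  f 0 = 0 -> g 0 = 0 -> forall p, p <> 0 -> 0 < f p.
Proof.
  intros Hd Hg Hf0 Hg0 p Hp.
  destruct (Rtotal_order p 0) as [H|[H|H]]; [|contradiction|].
  - destruct (MVT_is_derive f g p 0 H Hd) as [c [Hc Hc']].
    assert (g c < g 0) by (apply Hg; lra). nra.
  - destruct (MVT_is_derive f g 0 p H Hd) as [c [Hc Hc']].
    assert (g 0 < g c) by (apply Hg; lra). nra.
Qed.

(** Stands in for integrating a remainder estimate: [F x = G c * x] with [Rabs c <= Rabs x]. The
    factor 1/(n+1) of a true integration is given up, so [K] passes through unchanged. *)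
Lemma integrate_power_bound (F G : R -> R) (K : R) (n : nat) :
  0 <= K -> (forall x, is_derive F x (G x)) -> F 0 = 0 ->
  (forall x, Rabs (G x) <= K * Rabs x ^ n) ->
  forall x, Rabs (F x) <= K * Rabs x ^ S n.
Proof.
  intros HK Hd HF HG x.
  assert (Hc : exists c, F x = G c * x /\ Rabs c <= Rabs x).
  { destruct (Rtotal_order x 0) as [H|[->|H]].
    - destruct (MVT_is_derive F G x 0 H Hd) as [c [Hc Hc']].
      exists c. split; [lra|]. rewrite !Rabs_left; lra.
    - exists 0. split; lra.
    - destruct (MVT_is_derive F G 0 x H Hd) as [c [Hc Hc']].
      exists c. split; [lra|]. rewrite !Rabs_pos_eq; lra. }
  destruct Hc as [c [-> Hcx]].
  rewrite Rabs_mult. simpl.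
  replace (K * (Rabs x * Rabs x ^ n)) with (K * Rabs x ^ n * Rabs x) by ring.
  apply Rmult_le_compat_r; [apply Rabs_pos|].
  eapply Rle_trans; [apply HG|].
  apply Rmult_le_compat_l; [exact HK|].
  apply pow_incr. split; [apply Rabs_pos|exact Hcx].
Qed.

(** * The square root of the energy expression and the derivatives built from it *)

Lemma energy_pos (m p : R) : 0 < m -> 0 < m ^ 2 + p ^ 2.
Proof. intros Hm. nra. Qed.

Lemma sqrt_energy_pos (m p : R) : 0 < m -> 0 < sqrt (m ^ 2 + p ^ 2).
Proof. intros Hm. apply sqrt_lt_R0, energy_pos, Hm. Qed.

Lemma sqrt_energy_ge (m p : R) : 0 < m -> m <= sqrt (m ^ 2 + p ^ 2).
Proof.
  intros Hm. rewrite <- (sqrt_pow2 m) at 1 by lra.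
  apply sqrt_le_1_alt. nra.
Qed.

Lemma sqrt_energy_sqr (m p : R) :
  0 < m -> sqrt (m ^ 2 + p ^ 2) ^ 2 = m ^ 2 + p ^ 2.
Proof. intros Hm. apply pow2_sqrt, Rlt_le, energy_pos, Hm. Qed.

Lemma sqrt_energy_0 (m : R) : 0 < m -> sqrt (m ^ 2 + 0 ^ 2) = m.
Proof.
  intros Hm. replace (m ^ 2 + 0 ^ 2) with (m ^ 2) by ring. apply sqrt_pow2. lra.
Qed.

Lemma arcsinh_div_0 (m : R) : arcsinh (0 / m) = 0.
Proof. unfold Rdiv. rewrite Rmult_0_l. apply arcsinh_0. Qed.

Lemma is_derive_sqrt_energy (m p : R) : 0 < m ->
  is_derive (fun p => sqrt (m ^ 2 + p ^ 2)) p (p / sqrt (m ^ 2 + p ^ 2)).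
Proof.
  intros Hm. pose proof (energy_pos m p Hm). pose proof (sqrt_energy_pos m p Hm).
  auto_derive; [simpl in *; lra|].
  replace (m * (m * 1) + p * (p * 1)) with (m ^ 2 + p ^ 2) by ring.
  field. lra.
Qed.

Lemma is_derive_arcsinh_div (m p : R) : 0 < m ->
  is_derive (fun p => arcsinh (p / m)) p (/ sqrt (m ^ 2 + p ^ 2)).
Proof.
  intros Hm. pose proof (sqrt_energy_pos m p Hm).
  (* Scaling out [m] matches the derivative of [arcsinh], whose denominator is taken at [p / m]. *)
  assert (Hs : sqrt (m ^ 2 + p ^ 2) = m * sqrt ((p / m) ^ 2 + 1)).
  { rewrite <- (sqrt_pow2 m) at 2 by lra.
    rewrite <- sqrt_mult_alt by nra. f_equal. field. lra. }
  evar_last.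
  - apply (is_derive_comp arcsinh (fun p => p / m)).
    + apply is_derive_Reals, derivable_pt_lim_arcsinh.
    + auto_derive; [exact I|reflexivity].
  - rewrite Hs in H |- *. unfold scal; simpl; unfold mult; simpl.
    change (p / m * (p / m * 1)) with ((p / m) ^ 2).
    field. split; nra.
Qed.

(** The term p/s from the product rule cancels the derivative of the square root. What remains is
    the inverse of v -> m sinh v, as befits a Legendre transform. *)
Lemma is_derive_T_H (m p : R) : 0 < m -> is_derive (T_H m) p (arcsinh (p / m)).
Proof.
  intros Hm. pose proof (sqrt_energy_pos m p Hm).
  evar_last.
  - apply (is_derive_plus
      (fun p => p * arcsinh (p / m) - sqrt (m ^ 2 + p ^ 2)) (fun _ => m));
      [|apply is_derive_const].
    apply (is_derive_minus
      (fun p => p * arcsinh (p / m)) (fun p => sqrt (m ^ 2 + p ^ 2))).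
    + apply (is_derive_mult (fun p => p) (fun p => arcsinh (p / m)));
        [apply is_derive_id| |exact Rmult_comm].
      apply is_derive_arcsinh_div, Hm.
    + apply is_derive_sqrt_energy, Hm.
  - unfold minus, plus, opp, mult, one, zero; simpl.
    field. simpl in H. lra.
Qed.

Lemma is_derive_H_SR (m p : R) : 0 < m ->
  is_derive (H_SR m) p (p / sqrt (m ^ 2 + p ^ 2)).
Proof.
  intros Hm. evar_last.
  - apply (is_derive_minus (fun p => sqrt (m ^ 2 + p ^ 2)) (fun _ => m)).
    + apply is_derive_sqrt_energy, Hm.
    + apply is_derive_const.
  - apply Rminus_0_r.
Qed.

Lemma is_derive_T_H_minus_H_SR (m p : R) : 0 < m ->
  is_derive (fun p => T_H m p - H_SR m p) p
    (arcsinh (p / m) - p / sqrt (m ^ 2 + p ^ 2)).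
Proof.
  intros Hm. apply (is_derive_minus (T_H m) (H_SR m)).
  - apply is_derive_T_H, Hm.
  - apply is_derive_H_SR, Hm.
Qed.

(** Turns the real exponent into an integer power of s, within reach of field arithmetic. *)
Lemma Rpower_3_2 (x : R) : 0 < x -> Rpower x (3 / 2) = sqrt x ^ 3.
Proof.
  intros Hx. rewrite <- Rpower_sqrt by exact Hx.
  rewrite <- Rpower_pow by apply exp_pos.
  rewrite Rpower_mult. f_equal. simpl. lra.
Qed.

Lemma is_derive2_T_H_minus_H_SR (m p : R) : 0 < m ->
  is_derive (fun p => arcsinh (p / m) - p / sqrt (m ^ 2 + p ^ 2)) p
    (p ^ 2 / Rpower (m ^ 2 + p ^ 2) (3 / 2)).
Proof.
  intros Hm. pose proof (sqrt_energy_pos m p Hm) as Hs.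
  pose proof (sqrt_energy_sqr m p Hm) as Hsq.
  rewrite Rpower_3_2 by apply energy_pos, Hm.
  evar_last.
  - apply (is_derive_minus
      (fun p => arcsinh (p / m)) (fun p => p / sqrt (m ^ 2 + p ^ 2))).
    + apply is_derive_arcsinh_div, Hm.
    + apply (is_derive_div (fun p => p) (fun p => sqrt (m ^ 2 + p ^ 2)));
        [apply is_derive_id| |lra].
      apply is_derive_sqrt_energy, Hm.
  - set (s := sqrt (m ^ 2 + p ^ 2)) in *.
    unfold minus, plus, opp, one; simpl in *. field_simplify_eq; [|lra]. nra.
Qed.

Lemma second_derivative_pos (m p : R) : 0 < m -> p <> 0 ->
  0 < p ^ 2 / Rpower (m ^ 2 + p ^ 2) (3 / 2).
Proof.
  intros Hm Hp. apply Rdiv_lt_0_compat; [|apply exp_pos]. nra.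
Qed.

(** * Expansions at 0 with explicit remainder constants, valid for all p *)

Lemma H_SR_expansion (m p : R) : 0 < m ->
  Rabs (H_SR m p - (p ^ 2 / (2 * m) - p ^ 4 / (8 * m ^ 3)))
    <= / 16 * Rabs (p ^ 6 / m ^ 5).
Proof.
  intros Hm. unfold H_SR.
  pose proof (sqrt_energy_ge m p Hm) as Hs.
  pose proof (sqrt_energy_sqr m p Hm) as Hsq.
  set (s := sqrt (m ^ 2 + p ^ 2)) in *.
  assert (Hm5 : 0 < m ^ 5) by (apply pow_lt, Hm).
  assert (Hm3 : 0 < m ^ 3) by (apply pow_lt, Hm).
  replace (p ^ 6) with ((p ^ 2) ^ 3) by ring.
  replace (p ^ 4) with ((p ^ 2) ^ 2) by ring.
  replace (p ^ 2) with ((s - m) * (s + m)) by lra.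
  assert (Hsm : 0 <= (s - m) ^ 3) by (apply pow_le; lra).
  replace (s - m - _) with ((s - m) ^ 3 * (s + 3 * m) / (8 * m ^ 3))
    by (field; lra).
  (* This reduces to 2m^2(s+3m) <= (s+m)^3, which follows from s >= m through (s+m)^2 >= 4m^2 and
     2(s+m) >= s+3m. Equality at s = m shows where 1/16 comes from: it is the next Taylor
     coefficient. *)
  assert (Hquot : (s + 3 * m) / (8 * m ^ 3) <= / 16 * ((s + m) ^ 3 / m ^ 5)).
  { replace ((s + 3 * m) / (8 * m ^ 3))
      with (2 * m ^ 2 * (s + 3 * m) / (16 * m ^ 5)) by (field; lra).
    replace (/ 16 * ((s + m) ^ 3 / m ^ 5)) with ((s + m) ^ 3 / (16 * m ^ 5))
      by (field; lra).
    apply Rmult_le_compat_r; [apply Rlt_le, Rinv_0_lt_compat; lra|].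
    assert (4 * m ^ 2 <= (s + m) ^ 2) by nra. nra. }
  rewrite !Rabs_pos_eq.
  - rewrite Rpow_mult_distr.
    apply Rle_trans with ((s - m) ^ 3 * ((s + 3 * m) / (8 * m ^ 3)));
      [apply Req_le; field; lra|].
    apply Rle_trans with ((s - m) ^ 3 * (/ 16 * ((s + m) ^ 3 / m ^ 5)));
      [|apply Req_le; field; lra].
    apply Rmult_le_compat_l; assumption.
  - apply Rdiv_le_0_compat; [|exact Hm5].
    rewrite Rpow_mult_distr. apply Rmult_le_pos; [exact Hsm|apply pow_le; lra].
  - apply Rdiv_le_0_compat; [|lra]. apply Rmult_le_pos; [exact Hsm|lra].
Qed.

(** The quantity expanded is the second derivative of [T_H m]; the bound is shaped for
    [integrate_power_bound]. *)
Lemma inv_sqrt_energy_expansion (m p : R) : 0 < m ->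
  Rabs (/ sqrt (m ^ 2 + p ^ 2) - (/ m - p ^ 2 / (2 * m ^ 3)))
    <= 3 / 8 / m ^ 5 * Rabs p ^ 4.
Proof.
  intros Hm.
  pose proof (sqrt_energy_ge m p Hm) as Hs.
  pose proof (sqrt_energy_sqr m p Hm) as Hsq.
  set (s := sqrt (m ^ 2 + p ^ 2)) in *.
  assert (Hm5 : 0 < m ^ 5) by (apply pow_lt, Hm).
  assert (Hm3 : 0 < m ^ 3) by (apply pow_lt, Hm).
  replace (Rabs p ^ 4) with ((p ^ 2) ^ 2)
    by (rewrite <- (pow2_abs p); ring).
  replace (p ^ 2) with ((s - m) * (s + m)) by lra.
  assert (Hsm : 0 <= (s - m) ^ 2) by apply pow2_ge_0.
  replace (/ s - _) with ((s - m) ^ 2 * (s + 2 * m) / (2 * m ^ 3 * s))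
    by (field; lra).
  assert (Hden : 0 < 2 * m ^ 3 * s) by (apply Rmult_lt_0_compat; lra).
  (* Over the common denominator 8m^5 s this is the product of 4m^2 <= (s+m)^2 and s+2m <= 3s, both
     equalities at s = m. *)
  assert (Hquot : (s + 2 * m) / (2 * m ^ 3 * s) <= 3 / 8 / m ^ 5 * (s + m) ^ 2).
  { replace ((s + 2 * m) / (2 * m ^ 3 * s))
      with (4 * m ^ 2 * (s + 2 * m) / (8 * m ^ 5 * s)) by (field; lra).
    replace (3 / 8 / m ^ 5 * (s + m) ^ 2)
      with ((s + m) ^ 2 * (3 * s) / (8 * m ^ 5 * s)) by (field; lra).
    apply Rmult_le_compat_r.
    - apply Rlt_le, Rinv_0_lt_compat, Rmult_lt_0_compat; lra.
    - apply Rmult_le_compat; nra. }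
  rewrite Rabs_pos_eq.
  - rewrite Rpow_mult_distr.
    apply Rle_trans with ((s - m) ^ 2 * ((s + 2 * m) / (2 * m ^ 3 * s)));
      [apply Req_le; field; lra|].
    apply Rle_trans with ((s - m) ^ 2 * (3 / 8 / m ^ 5 * (s + m) ^ 2));
      [|apply Req_le; field; lra].
    apply Rmult_le_compat_l; assumption.
  - apply Rdiv_le_0_compat; [|exact Hden]. apply Rmult_le_pos; [exact Hsm|lra].
Qed.

(** Two applications of [integrate_power_bound] raise the power from 4 to 5 to 6, passing through
    [arcsinh (x / m)]. The constant stays 3/8, where exact integration would give 1/80. *)
Lemma T_H_expansion (m p : R) : 0 < m ->
  Rabs (T_H m p - (p ^ 2 / (2 * m) - p ^ 4 / (24 * m ^ 3)))
    <= 3 / 8 * Rabs (p ^ 6 / m ^ 5).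
Proof.
  intros Hm.
  assert (Hm5 : 0 < m ^ 5) by (apply pow_lt, Hm).
  assert (HK : 0 <= 3 / 8 / m ^ 5) by (apply Rdiv_le_0_compat; lra).
  assert (Harcsinh : forall x,
    Rabs (arcsinh (x / m) - (x / m - x ^ 3 / (6 * m ^ 3)))
      <= 3 / 8 / m ^ 5 * Rabs x ^ 5).
  { apply (integrate_power_bound
      (fun x => arcsinh (x / m) - (x / m - x ^ 3 / (6 * m ^ 3)))
      (fun x => / sqrt (m ^ 2 + x ^ 2) - (/ m - x ^ 2 / (2 * m ^ 3)))).
    - exact HK.
    - intros x. apply (is_derive_minus
        (fun x => arcsinh (x / m)) (fun x => x / m - x ^ 3 / (6 * m ^ 3))).
      + apply is_derive_arcsinh_div, Hm.
      + auto_derive; [exact I|field; lra].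
    - rewrite arcsinh_div_0. field. lra.
    - intros x. apply inv_sqrt_energy_expansion, Hm. }
  rewrite Rabs_div, <- RPow_abs, (Rabs_pos_eq (m ^ 5)) by lra.
  replace (3 / 8 * (Rabs p ^ 6 / m ^ 5)) with (3 / 8 / m ^ 5 * Rabs p ^ 6)
    by (field; lra).
  apply (integrate_power_bound
    (fun p => T_H m p - (p ^ 2 / (2 * m) - p ^ 4 / (24 * m ^ 3)))
    (fun x => arcsinh (x / m) - (x / m - x ^ 3 / (6 * m ^ 3)))).
  - exact HK.
  - intros x. apply (is_derive_minus (T_H m)
      (fun p => p ^ 2 / (2 * m) - p ^ 4 / (24 * m ^ 3))).
    + apply is_derive_T_H, Hm.
    + auto_derive; [exact I|field; lra].
  - unfold T_H. rewrite sqrt_energy_0, arcsinh_div_0 by exact Hm. field. lra.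
  - exact Harcsinh.
Qed.

Theorem proposition6p9 :
  (forall m : R, 0 < m ->
    T_H m <> H_SR m /\
    let f := fun p : R => T_H m p - H_SR m p in
    (forall p : R,
       f p = p * arcsinh (p / m) - 2 * sqrt (m ^ 2 + p ^ 2) + 2 * m) /\
    (forall p : R,
       ex_derive f p /\
       is_derive_n f 2 p (p ^ 2 / Rpower (m ^ 2 + p ^ 2) (3 / 2)) /\
       0 <= Derive_n f 2 p /\
       (Derive_n f 2 p = 0 <-> p = 0)) /\
    convex_on (fun _ : R => True) f /\
    (forall a b : Rbar, ~ Rbar_interval a b 0 ->
       strictly_convex_on (Rbar_interval a b) f) /\
    f 0 = 0 /\
    is_derive f 0 0 /\
    (forall p : R, p <> 0 -> T_H m p > H_SR m p)) /\
  bigO_at_0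
    (fun m p : R => T_H m p - (p ^ 2 / (2 * m) - p ^ 4 / (24 * m ^ 3)))
    (fun m p : R => p ^ 6 / m ^ 5) /\
  bigO_at_0
    (fun m p : R => H_SR m p - (p ^ 2 / (2 * m) - p ^ 4 / (8 * m ^ 3)))
    (fun m p : R => p ^ 6 / m ^ 5) /\
  bigO_at_0
    (fun m p : R => T_H m p - H_SR m p - p ^ 4 / (12 * m ^ 3))
    (fun m p : R => p ^ 6 / m ^ 5).
Proof.
  split; [|split; [|split]].
  - intros m Hm.
    pose proof (fun p => is_derive_T_H_minus_H_SR m p Hm) as Hd.
    pose proof (fun p => is_derive2_T_H_minus_H_SR m p Hm) as Hd2.
    pose proof (fun p => second_derivative_pos m p Hm) as Hpos.
    pose proof (strict_incr_derive_pos_except _ _ 0 Hd2 Hpos) as Hincr.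
    pose proof (strictly_convex_of_incr_derive _ _ Hd Hincr) as Hconv.
    assert (Hf0 : T_H m 0 - H_SR m 0 = 0).
    { unfold T_H, H_SR. rewrite sqrt_energy_0, arcsinh_div_0 by exact Hm. ring. }
    assert (Hf'0 : arcsinh (0 / m) - 0 / sqrt (m ^ 2 + 0 ^ 2) = 0).
    { rewrite arcsinh_div_0. unfold Rdiv. ring. }
    pose proof (pos_of_incr_derive _ _ Hd Hincr Hf0 Hf'0) as Hgt.
    assert (Hn2 : forall p, is_derive_n (fun p => T_H m p - H_SR m p) 2 p
                    (p ^ 2 / Rpower (m ^ 2 + p ^ 2) (3 / 2))).
    (* [is_derive_n] at order 2 differentiates [Derive f], which agrees everywhere with the explicit
       first derivative. *)
    { intros p. simpl. eapply is_derive_ext; [|apply Hd2].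
      intros t. symmetry. apply is_derive_unique, Hd. }
    split.
    { intros Heq. specialize (Hgt 1 R1_neq_R0). rewrite Heq in Hgt. lra. }
    intros f; subst f.
    split; [|split; [|split; [|split; [|split; [|split]]]]].
    + intros p. unfold T_H, H_SR. ring.
    + intros p. rewrite (is_derive_n_unique _ _ _ _ (Hn2 p)).
      split; [|split; [|split; [|split]]].
      * exists (arcsinh (p / m) - p / sqrt (m ^ 2 + p ^ 2)). apply Hd.
      * apply Hn2.
      * apply Rdiv_le_0_compat; [apply pow2_ge_0|apply exp_pos].
      * intros H. destruct (Req_dec p 0) as [|Hp]; [assumption|].
        specialize (Hpos p Hp). lra.
      * intros ->. unfold Rdiv. ring.
    + apply strictly_convex_convex, Hconv.
    + intros a b _. eapply strictly_convex_on_subset; [|exact Hconv].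
      intros; exact I.
    + exact Hf0.
    (* The second [0] is the value of the derivative, the first is the point. *)
    + rewrite <- Hf'0 at 2. apply Hd.
    + intros p Hp. specialize (Hgt p Hp). simpl in Hgt. lra.
  (* The estimate holds for every [p], so the neighbourhood can be the whole line. *)
  - exists (3 / 8). intros m Hm. apply filter_forall. intros p.
    apply T_H_expansion, Hm.
  - exists (/ 16). intros m Hm. apply filter_forall. intros p.
    apply H_SR_expansion, Hm.
  (* Subtracting the two expansions cancels the quadratic terms and leaves 1/8 - 1/24 = 1/12; the
     remainder constants add. *)
  - exists (3 / 8 + / 16). intros m Hm. apply filter_forall. intros p.
    rewrite Rmult_plus_distr_r.
    replace (T_H m p - H_SR m p - p ^ 4 / (12 * m ^ 3))
      with (T_H m p - (p ^ 2 / (2 * m) - p ^ 4 / (24 * m ^ 3))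
            - (H_SR m p - (p ^ 2 / (2 * m) - p ^ 4 / (8 * m ^ 3))))
      by (field; lra).
    eapply Rle_trans; [apply Rabs_triang|]. rewrite Rabs_Ropp.
    apply Rplus_le_compat; [apply T_H_expansion|apply H_SR_expansion]; exact Hm.
Qed.
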